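(* Let $$M=\begin{bmatrix} M_1 & C_{12} & C_{13} &\cdots & C_{1k}\\ C_{12}^T & M_2 & C_{23} &\cdots & C_{2k}\\ C_{13}^T & C_{23}^T & M_3 &\cdots & C_{3k}\\ \vdots & \vdots & \vdots & \ddots & \vdots\\ C_{1k}^T & C_{2k}^T & C_{3k}^T & \cdots & M_k\end{bmatrix}$$ be a real symmetric matrix, where $M_j$ is an $n_j\times n_j$ symmetric matrix and $C_{ij}$ is an $n_i\times n_j$ matrix. Suppose there exist nonzero vectors $\mathbf{w}_j\in\mathbb{R}^{n_j}$, $1\le j\le k$, and real scalars $\lambda_j,\alpha_{ij},\beta_{ij}$ such that $$M_j\mathbf{w}_j=\lambda_j\mathbf{w}_j\ (1\le j\le k),\qquad C_{ij}\mathbf{w}_j=\alpha_{ij}\mathbf{w}_i,\qquad C_{ij}^T\mathbf{w}_i=\beta_{ij}\mathbf{w}_j\quad (1\le i<j\le k).$$ Let $\mathbf{u}_j=[0,\ldots,0,\mathbf{w}_j,0,\ldots,0]^T$, where $\mathbf{w}_j$ occupies the $j$th block, and suppose that each $\mathbf{u}_j$ is a unit vector (so that $\alpha_{ij}=\beta_{ij}$ for all $i<j$). Let $H=(h_{ij})_{i,j=1}^k$ be the real symmetric matrix with $h_{ij}=\alpha_{ij}$ if $i<j$, $h_{jj}=\lambda_j$, and $h_{ij}=\beta_{ji}$ if $i>j$. Then, for distinct $a,b\in\{1,\dots,k\}$, the graph associated with the matrix $H$ exhibits fractional revival from vertex $a$ to vertex $b$ if and only if the graph associated with the matrix $M$ exhibits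 fractional revival from $\mathbf{u}_a$ to $\mathbf{u}_b$.
   Context: For a real symmetric matrix $N$, put $U_N(t)=\exp(itN)$, $t\in\mathbb{R}$; the (weighted) graph associated with $N$ is the graph whose continuous-time quantum walk has Hamiltonian $N$. For linearly independent vectors (states) $\mathbf{u},\mathbf{v}$, the graph associated with $N$ exhibits fractional revival from $\mathbf{u}$ to $\mathbf{v}$ if there exist a time $\tau$ and complex scalars $\alpha,\beta$ with $\beta\neq0$ such that $U_N(\tau)\mathbf{u}=\alpha\mathbf{u}+\beta\mathbf{v}$. Fractional revival from vertex $a$ to vertex $b$ means fractional revival from the standard basis vector $\mathbf{e}_a$ to $\mathbf{e}_b$. *)

(* Defs.v *)
From mathcomp Require Export all_boot all_order all_algebra complex.
From mathcomp Require Export all_classical all_reals all_analysis.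
Export numFieldNormedType.Exports.

Set Implicit Arguments.
Unset Strict Implicit.
Unset Printing Implicit Defensive.

Import Order.TTheory GRing.Theory Num.Theory.
Local Open Scope complex_scope.
Local Open Scope classical_set_scope.
Local Open Scope ring_scope.

(* The limit is taken in the entrywise topology on matrices.  The field is
   abstract because R[i] only gets its topology as a numFieldType. *)
Definition expmx (K : numFieldType) (n : nat) (A : 'M[K]_n) : 'M[K]_n :=
  limn (series (fun m => (m`!%:R)^-1 *: A ^+ m)).

Definition toC (R : realType) (m n : nat) (A : 'M[R]_(m, n)) : 'M[R[i]]_(m, n) :=
  map_mx (real_complex R) A.

Definition transition (R : realType) (n : nat) (N : 'M[R]_n) (t : R) :
    'M[R[i]]_n :=
  expmx (('i * t%:C) *: toC N).

(* The Hamiltonian N is meant to be symmetric; states are complex. *)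
Definition fractional_revival (R : realType) (n : nat) (N : 'M[R]_n)
    (u v : 'cV[R[i]]_n) : Prop :=
  free [:: u; v] /\
  exists (tau : R) (a b : R[i]),
    b != 0 /\ transition N tau *m u = a *: u + b *: v.

Definition vertex_state (R : realType) (n : nat) (a : 'I_n) : 'cV[R[i]]_n :=
  delta_mx a 0.

(* The library norm `|v| on column vectors is the sup norm. *)
Definition unit_vector (R : realType) (n : nat) (v : 'cV[R]_n) : Prop :=
  Num.sqrt (\sum_l v l 0 ^+ 2) = 1.

(* The test is on the running index i, so that w is never cast between blocks. *)
Definition block_vec (R : realType) (k : nat) (n_ : 'I_k -> nat)
    (w : forall j : 'I_k, 'cV[R]_(n_ j)) (j : 'I_k) : 'cV[R]_(\sum_i n_ i) :=
  \mxcol_(i < k) (if i == j then w i else 0).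

Definition quotient_mx (R : realType) (k : nat) (lambda : 'I_k -> R)
    (alpha beta : 'I_k -> 'I_k -> R) : 'M[R]_k :=
  \matrix_(i, j) if (i < j)%N then alpha i j
                 else if i == j then lambda j else beta j i.

(* Main.v *)
Require Import Defs.

(** Let W be the matrix whose columns are the vectors u_1, ..., u_k.  As M is
    symmetric, the hypotheses on its blocks say exactly that M W = W H
    ([mul_block_frame]): in block row i, M u_j is h_ij w_i.  The u_j have disjoint supports and norm 1,
    so W^T W = 1 ([block_frame_orthonormal]).

    It follows that H = W^T M W is symmetric, because M is; off the diagonal
    this is the equality of alpha and beta.

    It also follows that M^p W = W H^p for all p, so that, term by term in the
    exponential series, exp(itM) W = W exp(itH) ([transition_intertwine]).  As
    W maps e_j to u_j, applying W to exp(itH) e_a = x e_a + y e_b gives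
    exp(itM) u_a = x u_a + y u_b, and applying W^T leads back, with the same
    t, x, y.  Linear independence is
    transported in the same way ([fractional_revival_intertwine]).

    Passing to the limit in the series requires the exponential series of a
    complex matrix to converge: otherwise its limit would be an arbitrary
    value.  The entries of A^p are bounded by c^p, where c is the sum of the
    moduli of the entries of A ([norm_exprmx_entry]), so the real series of
    exp(c) dominates every entry; comparison of a complex series with a real
    one is reduced to real and imaginary parts ([is_cvg_series_complex]). *)

Import Order.TTheory GRing.Theory Num.Theory.
Local Open Scope classical_set_scope.
Local Open Scope ring_scope.

Local Notation Re := complex.Re.
Local Notation Im := complex.Im.
(* Limits of complex sequences are found through this view of R[i] as a
   numFieldType, the only one from which its topology is inferred. *)
Local Notation Cnum R := ((R[i] : numFieldType) : Type).

Set Implicit Arguments.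
Unset Strict Implicit.

(** * Comparison of complex series with real series *)

Lemma normRe_le (R : realType) (z : R[i]) (r : R) :
  `|z| <= (r%:C)%C -> `|Re z| <= r.
Proof. by move=> zr; rewrite -lecR (le_trans (normc_ge_Re z)). Qed.

Lemma normIm_le (R : realType) (z : R[i]) (r : R) :
  `|z| <= (r%:C)%C -> `|Im z| <= r.
Proof.
(* Up to sign, Im z is the real part of z * 'i, which has the modulus of z. *)
move=> zr; rewrite -normrN -ReiNIm normRe_le// normrM.
by rewrite complexiE normCi mulr1.
Qed.

Lemma is_cvg_complex (R : realType) (u : nat -> Cnum R) :
  cvgn (fun n => Re (u n)) -> cvgn (fun n => Im (u n)) -> cvgn u.
Proof.
move=> /cvg_ex[a ua] /cvg_ex[b ub]; apply/cvg_ex; exists (a +i* b)%C.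
apply/cvgrPdist_lt => -[e e'] e_gt0.
(* The radius is a complex number, but being positive forces it to be real. *)
have [e'0 e0] : e' = 0 /\ 0 < e.
  by move: e_gt0; rewrite ltcE/= => /andP[/eqP -> ->].
rewrite {e_gt0 e'}e'0; near=> n.
have -> : ((a +i* b)%C - u n) =
    ((a - Re (u n))%:C + 'i * (b - Im (u n))%:C)%C.
  by rewrite {1}[u n]complexE; case: (u n) => x y; simpc.
rewrite (le_lt_trans (ler_normD _ _))// normrM normCi mul1r.
rewrite !normc_def/= !expr0n !addr0 !sqrtr_sqr.
rewrite -rmorphD/= ltcR (splitr e) ltrD//; near: n.
- by apply: (cvgr_dist_lt _ _ ua); rewrite divr_gt0.
- by apply: (cvgr_dist_lt _ _ ub); rewrite divr_gt0.
Unshelve. all: by end_near. Qed.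

(** The real and the imaginary parts of the terms are dominated by v, so their
    series converge absolutely, by completeness of R. *)
Lemma is_cvg_series_complex (R : realType) (u : nat -> Cnum R) (v : nat -> R) :
  (forall n, `|u n| <= ((v n)%:C)%C) -> cvgn (series v) -> cvgn (series u).
Proof.
move=> uv cv.
(* Shared argument for f = Re and f = Im. *)
have real_part (f : {additive Rcomplex R -> R}) :
    (forall n, `|f (u n)| <= v n) -> cvgn (fun n => f (series u n)).
  move=> fuv; have -> : (fun n => f (series u n)) = series (fun n => f (u n)).
    by apply/funext => n; rewrite /series/= (raddf_sum f).
  apply: (@normed_cvg R R^o); apply: series_le_cvg cv => //= n.
  exact: le_trans (fuv n).
apply: is_cvg_complex.
- by apply: (real_part (@Re R : Rcomplex R -> R)) => n; exact: normRe_le.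
- by apply: (real_part (@Im R : Rcomplex R -> R)) => n; exact: normIm_le.
Qed.

(** * Convergence of the matrix exponential *)

Lemma cvg_mx_entries (T : topologicalType) (m n : nat) (F : nat -> 'M[T]_(m, n))
    (A : 'M[T]_(m, n)) :
  (forall i j, F p i j @[p --> \oo] --> A i j) -> F @ \oo --> A.
Proof.
move=> FA B [P AP sPB].
suff FP : \forall p \near \oo, forall i j, P i j (F p i j).
  by apply: filterS FP => p; exact: sPB.
apply: filter_forall => i; apply: filter_forall => j.
exact: FA (AP i j).
Qed.

(** The sum of the moduli of the entries dominates each absolute row sum, which
    is what the induction on the exponent consumes. *)
Lemma norm_exprmx_entry (K : numDomainType) (n : nat) (A : 'M[K]_n) (p : nat)
    (i j : 'I_n) :
  `|(A ^+ p) i j| <= (\sum_k \sum_l `|A k l|) ^+ p.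
Proof.
elim: p i j => [|p IHp] i j.
  by rewrite expr0 mxE; case: eqP; rewrite ?normr1 ?normr0.
rewrite !exprS mxE (le_trans (ler_norm_sum _ _ _))//.
have sum0 : 0 <= \sum_k \sum_l `|A k l| by do 2 apply: sumr_ge0 => ? _.
(* Each factor A^p l j is bounded uniformly in l; row i of A remains. *)
rewrite (@le_trans _ _ ((\sum_l `|A i l|) * (\sum_k \sum_l `|A k l|) ^+ p))//.
  by rewrite mulr_suml ler_sum// => l _; rewrite normrM ler_wpM2l.
rewrite ler_wpM2r ?exprn_ge0// [leRHS](bigD1 i)//= lerDl.
by do 2 apply: sumr_ge0 => ? _.
Qed.

(** Entrywise comparison with the exponential series of the real number
    underlying the sum of the moduli of the entries. *)
Lemma is_cvg_series_expmx (R : realType) (n : nat) (A : 'M[R[i]]_n) :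
  cvgn (series (fun m => (m`!%:R)^-1 *: A ^+ m) : nat -> 'M[Cnum R]_n).
Proof.
pose a : nat -> 'M[R[i]]_n := fun m => (m`!%:R)^-1 *: A ^+ m.
pose c : R := Re (\sum_k \sum_l `|A k l|).
have cE : (c%:C)%C = \sum_k \sum_l `|A k l|.
  by rewrite RRe_real// ger0_real//; do 2 apply: sumr_ge0 => ? _.
have cvg_entry i j : cvgn ((fun m => series a m i j) : nat -> Cnum R).
  have -> : (fun m => series a m i j) = series (fun m => a m i j).
    by apply/funext => m; rewrite /series/= summxE.
  apply: is_cvg_series_complex (is_cvg_series_exp_coeff c) => m.
  rewrite /a mxE normrM normfV normr_nat exp_coeffE rmorphM/= fmorphV rmorph_nat.
  by rewrite ler_wpM2l ?invr_ge0// rmorphXn/= cE norm_exprmx_entry.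
apply/cvg_ex.
exists (\matrix_(i, j) limn ((fun m => series a m i j) : nat -> Cnum R)).
by apply: cvg_mx_entries => i j; rewrite mxE; exact: cvg_entry.
Qed.

(** * Intertwining of exponentials and of quantum walks *)

Lemma exprmx_intertwine (K : pzRingType) (m n : nat) (A : 'M[K]_m) (B : 'M[K]_n)
    (P : 'M[K]_(m, n)) (p : nat) :
  A *m P = P *m B -> A ^+ p *m P = P *m B ^+ p.
Proof.
move=> AP; elim: p => [|p IHp]; first by rewrite !expr0 mul1mx mulmx1.
by rewrite !exprSr -!mulmxE -mulmxA AP mulmxA IHp mulmxA.
Qed.

Lemma cvg_mulmx (K : numFieldType) (m n p : nat) (F : nat -> 'M[K]_(m, n))
    (G : nat -> 'M[K]_(n, p)) (A : 'M[K]_(m, n)) (B : 'M[K]_(n, p)) :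
  F @ \oo --> A -> G @ \oo --> B -> F q *m G q @[q --> \oo] --> A *m B.
Proof.
move=> FA GB; apply: cvg_mx_entries => i j; rewrite mxE.
under eq_cvg do rewrite mxE.
apply: cvg_big => [|l _]; first exact: add_continuous.
apply: (@cvgM _ _ _ _ (fun q => F q i l) (fun q => G q l j)).
- exact: (cvg_comp _ _ FA (@coord_continuous _ _ _ i l A)).
- exact: (cvg_comp _ _ GB (@coord_continuous _ _ _ l j B)).
Qed.

(** The partial sums of both exponentials are intertwined by P, and
    multiplication by P is continuous.  Convergence is assumed because the
    field need not be complete. *)
Lemma expmx_intertwine (K : numFieldType) (m n : nat) (A : 'M[K]_m)
    (B : 'M[K]_n) (P : 'M[K]_(m, n)) :
  cvgn (series (fun q => (q`!%:R)^-1 *: A ^+ q)) ->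
  cvgn (series (fun q => (q`!%:R)^-1 *: B ^+ q)) ->
  A *m P = P *m B -> expmx A *m P = P *m expmx B.
Proof.
move=> cA cB AP.
have cP : (fun _ : nat => P) @ \oo --> P by exact: cvg_cst.
have AB := cvg_mulmx cA cP.
have PB := cvg_mulmx cP cB.
have sepM : hausdorff_space 'M[K]_(m, n) by exact: norm_hausdorff.
apply: (cvg_unique sepM AB).
have -> : (fun q => series (fun l => (l`!%:R)^-1 *: A ^+ l) q *m P) =
    (fun q => P *m series (fun l => (l`!%:R)^-1 *: B ^+ l) q) => //.
apply/funext => q.
rewrite /series/= mulmx_suml mulmx_sumr; apply: eq_bigr => l _.
by rewrite -scalemxAr -scalemxAl (exprmx_intertwine _ AP).
Qed.

Lemma transition_intertwine (R : realType) (m n : nat) (M : 'M[R]_m)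
    (H : 'M[R]_n) (W : 'M[R]_(m, n)) (t : R) :
  M *m W = W *m H -> transition M t *m toC W = toC W *m transition H t.
Proof.
move=> MW; apply: expmx_intertwine; [exact: is_cvg_series_expmx..|].
by rewrite -scalemxAl -scalemxAr /toC -!map_mxM MW.
Qed.

(** A linear relation can be pushed through any matrix: through P in one
    direction, through its left inverse Q in the other. *)
Lemma free_mulmx (K : fieldType) (m n : nat) (Q : 'M[K]_(n, m))
    (P : 'M[K]_(m, n)) (x y : 'cV[K]_n) :
  Q *m P = 1%:M -> free [:: P *m x; P *m y] = free [:: x; y].
Proof.
move=> QP.
have mul_free (p q : nat) (A : 'M[K]_(p, q)) (u v : 'cV[K]_q) :
    free [:: A *m u; A *m v] -> free [:: u; v].
  move=> /freeP Auv; apply/freeP => k; rewrite big_ord_recl big_ord1 /= => kuv.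
  apply: Auv; rewrite big_ord_recl big_ord1/=.
  by rewrite !scalemxAr -mulmxDr kuv mulmx0.
apply/idP/idP; first exact: mul_free.
by move=> xy; apply: (mul_free _ _ Q); rewrite !mulmxA QP !mul1mx.
Qed.

(** An isometry W that intertwines H and M conjugates the walk of H with the
    walk of M on its range, so fractional revival is seen identically on both
    sides, with the same time and coefficients. *)
Lemma fractional_revival_intertwine (R : realType) (m n : nat) (M : 'M[R]_m)
    (H : 'M[R]_n) (W : 'M[R]_(m, n)) (x y : 'cV[R[i]]_n) :
  M *m W = W *m H -> W^T *m W = 1%:M ->
  fractional_revival H x y <->
  fractional_revival M (toC W *m x) (toC W *m y).
Proof.
move=> MW WTW.
have WTWC : toC W^T *m toC W = 1%:M by rewrite /toC -map_mxM WTW map_mx1.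
rewrite /fractional_revival (free_mulmx _ _ WTWC).
have revivalE t a b : transition H t *m x = a *: x + b *: y <->
    transition M t *m (toC W *m x) = a *: (toC W *m x) + b *: (toC W *m y).
  rewrite mulmxA (transition_intertwine t MW) -mulmxA !scalemxAr -mulmxDr.
  split=> [-> //|/(congr1 (mulmx (toC W^T)))].
  by rewrite !mulmxA WTWC !mul1mx.
by split=> -[xy [t [a [b [b0 /revivalE tab]]]]]; split=> //; exists t, a, b.
Qed.

(** * The frame of block vectors *)

Section BlockFrame.
Variables (R : realType) (k : nat) (n_ : 'I_k -> nat).
Implicit Types (w : forall j : 'I_k, 'cV[R]_(n_ j)) (M : 'M[R]_(\sum_i n_ i)).

(** The matrix with columns u_1, ..., u_k, cut into block rows: block row i is
    w_i placed in column i.  In this form it multiplies with block matrices by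
    the block product lemmas, without any index transport. *)
Definition block_frame w : 'M[R]_(\sum_i n_ i, k) :=
  \mxcol_i (w i *m delta_mx 0 i).

Lemma block_frame_vertex w (j : 'I_k) :
  block_frame w *m delta_mx j 0 = block_vec w j.
Proof.
rewrite mxcol_mul; apply: eq_mxcol => i.
rewrite -mulmxA mul_delta_mx_cond; case: eqP => _; last by rewrite mulmx0.
by apply/matrixP => x y; rewrite mxE big_ord1 !mxE !ord1 mulr1.
Qed.

Lemma toC_block_frame_vertex w (j : 'I_k) :
  toC (block_frame w) *m vertex_state R j = toC (block_vec w j).
Proof. by rewrite -block_frame_vertex /toC map_mxM map_delta_mx. Qed.

(** The Gram matrix is 1 by 1, so normalisation becomes an equation between
    matrices, usable inside block products. *)
Lemma unit_block_vec w (j : 'I_k) :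
  unit_vector (block_vec w j) -> (w j)^T *m w j = 1%:M.
Proof.
move=> wj1; have : (block_vec w j)^T *m block_vec w j = (w j)^T *m w j.
  rewrite tr_mxcol mul_mxrow_mxcol (bigD1 j)//= eqxx big1 ?addr0// => i /negPf ->.
  by rewrite mulmx0.
move=> <-; apply/matrixP => x y; rewrite !ord1 !mxE.
have := congr1 (fun r => r ^+ 2) wj1; rewrite /= expr1n sqr_sqrtr.
  by move=> <-; apply: eq_bigr => l _; rewrite mxE expr2.
by apply: sumr_ge0 => l _; exact: sqr_ge0.
Qed.

Lemma block_frame_orthonormal w :
  (forall j, unit_vector (block_vec w j)) ->
  (block_frame w)^T *m block_frame w = 1%:M.
Proof.
move=> w1; rewrite tr_mxcol mul_mxrow_mxcol.
under eq_bigr => j _ do rewrite trmx_mul -mulmxA (mulmxA _ (w j))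
  unit_block_vec// mul1mx trmx_delta mul_delta_mx.
apply/matrixP => x y; rewrite summxE (bigD1 x)//= big1 ?addr0 => [|i ix].
  by rewrite !mxE eqxx/= eq_sym.
by rewrite mxE eq_sym (negPf ix).
Qed.

(** In block row i both sides are w_i times row i of H. *)
Lemma mul_block_frame M w (H : 'M[R]_k) :
  (forall i j, submxblock M i j *m w j = H i j *: w i) ->
  M *m block_frame w = block_frame w *m H.
Proof.
move=> Mw; rewrite -{1}[M]submxblockK mul_mxblock_mxrow mxcol_mul.
apply: eq_mxcol => i; rewrite -mulmxA -rowE [row i H]row_sum_delta.
rewrite mulmx_sumr; apply: eq_bigr => j _.
by rewrite mulmxA Mw -scalemxAl -scalemxAr mxE.
Qed.

End BlockFrame.

Theorem theorem5 (R : realType) (k : nat) (n_ : 'I_k -> nat)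
    (M : 'M[R]_(\sum_i n_ i)) (hM : M^T = M)
    (w : forall j : 'I_k, 'cV[R]_(n_ j))
    (lambda : 'I_k -> R) (alpha beta : 'I_k -> 'I_k -> R)
    (hw : forall j, w j != 0)
    (hdiag : forall j, submxblock M j j *m w j = lambda j *: w j)
    (hupper : forall i j : 'I_k, (i < j)%N ->
      submxblock M i j *m w j = alpha i j *: w i)
    (hlower : forall i j : 'I_k, (i < j)%N ->
      (submxblock M i j)^T *m w i = beta i j *: w j)
    (hunit : forall j, unit_vector (block_vec w j)) :
  (forall i j : 'I_k, (i < j)%N -> alpha i j = beta i j) /\
  (forall a b : 'I_k, a != b ->
    fractional_revival (quotient_mx lambda alpha beta)
      (vertex_state R a) (vertex_state R b) <->
    fractional_revival M (toC (block_vec w a)) (toC (block_vec w b))).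
Proof.
set H := quotient_mx lambda alpha beta; set W := block_frame w.
have WTW : W^T *m W = 1%:M by exact: block_frame_orthonormal.
have MW : M *m W = W *m H.
  apply: mul_block_frame => i j; rewrite mxE.
  case: ltngtP => [ij|ji|/val_inj <-]; first exact: hupper.
  - by rewrite ifN ?gt_eqF// -hlower// tr_submxblock hM.
  - by rewrite eqxx hdiag.
split=> [i j ij|a b _].
  (* H is the compression of the symmetric matrix M by W. *)
  have HT : H^T = H.
    have HE : H = W^T *m M *m W by rewrite -mulmxA MW mulmxA WTW mul1mx.
    by rewrite {1}HE !trmx_mul hM trmxK mulmxA -HE.
  move/matrixP/(_ j i): HT; rewrite !mxE ij ltnNge ltnW//= ifN//.
  by rewrite neq_ltn ij orbT.
by rewrite -!toC_block_frame_vertex; exact: fractional_revival_intertwine.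
Qed.
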